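(* There is a constant $c$ such that for all integers $s\geq 0$ and $t\geq 3$ with $s \leq 10^{-5}\,\frac{t}{\ln t}$, for every graph $H$ with exactly $s+t$ vertices and every set $S$ of vertices in $H$ of size $s$, $$f(H) \leq c\,t\sqrt{\ln(d(H-S)+2)}.$$
   Context: Graphs are finite and simple. For a graph $G$, $d(G)$ denotes the average degree of $G$, i.e. $d(G)=2|E(G)|/|V(G)|$. A graph $H$ is a minor of a graph $G$ (equivalently, $G$ contains an $H$-minor) if a graph isomorphic to $H$ can be constructed from $G$ by vertex deletion, edge deletion and edge contraction. For a graph $H$, define $$f(H) := \inf\{D \in \mathbb{R} : \text{every graph } G \text{ with } d(G)\geq D \text{ contains an } H\text{-minor}\}.$$ For $S\subseteq V(H)$, $H-S$ is the graph obtained from $H$ by deleting the vertices in $S$. *)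

(* Defs.v *)
From HB Require Import structures.
From mathcomp Require Import all_boot all_order all_algebra.
From mathcomp Require Import boolp classical_sets reals constructive_ereal ereal exp.

Set Implicit Arguments.
Unset Strict Implicit.
Unset Printing Implicit Defensive.

Import Order.TTheory GRing.Theory Num.Theory.

Local Open Scope ring_scope.

Record sgraph := SGraph {
  vert :> finType;
  adj : rel vert;
  adj_sym : symmetric adj;
  adj_irr : irreflexive adj }.

Definition edges (G : sgraph) : {set {set G}} :=
  [set e : {set G} | [exists x, exists y, adj x y && (e == [set x; y])]]%SET.

(* On the graph without vertices this is 0 / 0 = 0. *)
Definition avg_deg (R : realType) (G : sgraph) : R :=
  2 * #|edges G|%:R / #|G|%:R.

Section Operations.
Variable G : sgraph.

Section DeleteVertices.
Variable S : {set G}.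

Definition del_vertices_adj : rel {x : G | x \notin S} :=
  [rel u v | adj (val u) (val v)].

Lemma del_vertices_sym : symmetric del_vertices_adj.
Proof. by move=> u v; apply: adj_sym. Qed.

Lemma del_vertices_irr : irreflexive del_vertices_adj.
Proof. by move=> u; apply: adj_irr. Qed.

Definition del_vertices : sgraph := SGraph del_vertices_sym del_vertices_irr.
End DeleteVertices.

Section EdgeOperations.
Variables x y : G.

Definition del_edge_adj : rel G :=
  [rel u v | adj u v && ([set u; v]%SET != [set x; y]%SET)].

Lemma del_edge_sym : symmetric del_edge_adj.
Proof. by move=> u v; rewrite /del_edge_adj /= adj_sym finset.setUC. Qed.

Lemma del_edge_irr : irreflexive del_edge_adj.
Proof. by move=> u; rewrite /del_edge_adj /= adj_irr. Qed.

Definition del_edge : sgraph := SGraph del_edge_sym del_edge_irr.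

(* [x] plays the role of the vertex into which the edge [xy] is contracted;
   the loop and the parallel edges that arise are discarded. *)
Definition contract_adj : rel {z : G | z != y} :=
  [rel u v | (u != v) &&
     [|| adj (val u) (val v),
         (val u == x) && adj y (val v) |
         (val v == x) && adj y (val u)]].

Lemma contract_sym : symmetric contract_adj.
Proof.
move=> u v; rewrite /contract_adj /= eq_sym (adj_sym (val u)); congr (_ && (_ || _)).
exact: orbC.
Qed.

Lemma contract_irr : irreflexive contract_adj.
Proof. by move=> u; rewrite /contract_adj /= eqxx. Qed.

Definition contract : sgraph := SGraph contract_sym contract_irr.
End EdgeOperations.
End Operations.

Definition isomorphic (G H : sgraph) : Prop :=
  exists2 h : G -> H, bijective h & forall u v, adj (h u) (h v) = adj u v.

(* [minor H G]: [H] is a minor of [G]. *)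
Inductive minor (H : sgraph) : sgraph -> Prop :=
| minor_iso (G : sgraph) : isomorphic H G -> minor H G
| minor_del_vertex (G : sgraph) (x : G) :
    minor H (del_vertices [set x]%SET) -> minor H G
| minor_del_edge (G : sgraph) (x y : G) :
    adj x y -> minor H (del_edge x y) -> minor H G
| minor_contract (G : sgraph) (x y : G) :
    adj x y -> minor H (contract x y) -> minor H G.

(* The infimum is taken in the extended reals, so that an empty set of
   thresholds gives [+oo] and not the default value of a real infimum. *)
Definition extremal (R : realType) (H : sgraph) : \bar R :=
  ereal_inf (EFin @` [set D : R | forall G : sgraph,
                                    D <= avg_deg R G -> minor H G])%classic.

(* Main.v *)
Require Import Defs.
From HB Require Import structures.
From mathcomp Require Import all_boot all_order all_algebra.
From mathcomp Require Import zify lra.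
From mathcomp Require Import boolp.

(** The bound follows from a greedy construction of branch sets inside a dense
    minor of [G].

    Dense minor. Take a minor of [G] that is minimal subject to having at least
    [k n] edges on [n] vertices. Contracting an edge destroys one edge plus one
    per common neighbour of its ends, so every edge has at least [k] common
    neighbours; some vertex has degree at most [2 k], and its neighbourhood is a
    graph on at most [2 k] vertices of minimum degree at least [k]. Repeating
    this inside the neighbourhood with the threshold [n (n + 2 k) / 8], whose
    quotient by [n] grows with [n], makes twice the minimum degree of the next
    neighbourhood exceed its order by a constant fraction of [k]
    ([dense_neighbourhood_minor]). Hence there is a minor [M] of order [O(k)] in
    which any two vertices have at least [h] common neighbours, [h] being
    proportional to [k].

    Branch sets. In [M], as long as at most [h / 2] vertices are used, every
    vertex is adjacent to a constant fraction of the unused ones. Averaging over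
    the next vertex to pick, one finds [l] unused vertices that leave only an
    exponentially small (in [l]) proportion [eps] of [M] undominated. If earlier
    branch sets already leave only a proportion [eps] undominated, the same
    averaging lets the new set miss only a proportion of about [eps ^ l], that
    is [exp (- c l ^ 2)], of any prescribed [b] earlier branch sets
    ([greedy_pick], [dominating_pick]). Common neighbours outside the used
    vertices then connect the set and repair the few missed adjacencies, one
    vertex each ([branch_set]).

    Counting. Each vertex of [S] gets a set of [O(ln t)] vertices that dominates
    all of [M]; since [s <= 10 ^- 5 t / ln t], these use [O(t)] vertices
    ([place_dominating]). The vertices of [H - S] get sets of size [O(l)] with
    [l] proportional to [sqrt (ln (d + 2))], where [d] is the average degree of
    [H - S]: then [exp (- c l ^ 2)] is below [1 / (d + 2)], so that the repairs
    for all edges of [H - S] together use [O(t)] vertices ([place_sparse]).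
    Altogether [O(t l)] vertices suffice, which is at most [h / 2] when [k] is a
    large multiple of [t l] ([sparse_model]). *)

Set Implicit Arguments.
Unset Strict Implicit.
Unset Printing Implicit Defensive.

Import Order.TTheory GRing.Theory Num.Theory.

Local Open Scope nat_scope.

(** * Minor models *)

Lemma connect_map (T T' : finType) (e : rel T) (e' : rel T') (f : T -> T') :
  (forall u v, e u v -> connect e' (f u) (f v)) ->
  forall u v, connect e u v -> connect e' (f u) (f v).
Proof.
move=> sub u v /connectP[p]; elim: p u => [|w p IHp] u /= => [_ -> //|].
by case/andP=> /sub uw /IHp wv /wv; apply: connect_trans.
Qed.

Definition fibre_link (G : sgraph) (T : eqType) (f : G -> option T) : rel G :=
  [rel u v | adj u v && (f u == f v)].

(** [f] sends the vertices of the branch set of [a] to [Some a], and the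
    vertices to be deleted to [None]. *)
Definition model_map (H G : sgraph) (f : G -> option H) : Prop :=
  [/\ forall a, exists x, f x = Some a,
      forall x y, f x != None -> f x = f y -> connect (fibre_link f) x y
    & forall a b, adj a b -> exists x y, [/\ f x = Some a, f y = Some b & adj x y]].

Definition model (H G : sgraph) : Prop := exists f : G -> option H, model_map f.

Lemma model_del_vertices (H G : sgraph) (X : {set G}) :
  model H (del_vertices X) -> model H G.
Proof.
case=> f [fS fC fA].
pose f' x : option H := if insub x is Some u then f u else None.
have f'E (u : del_vertices X) : f' (val u) = f u by rewrite /f' valK.
exists f'; split.
- by move=> a; have [u fu] := fS a; exists (val u); rewrite f'E.
- move=> x y; rewrite {1 2}/f'; case: insubP => // u _ <- fu; rewrite {1}/f'.
  case: insubP => [v _ <- fuv|_ fu0]; last by rewrite fu0 in fu.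
  apply: (connect_map _ (fC u v fu fuv)) => u' v' /andP[auv /eqP fe].
  by apply: connect1; rewrite /fibre_link /= !f'E fe eqxx andbT.
- move=> a b /fA[u [v [fu fv auv]]].
  by exists (val u), (val v); rewrite !f'E.
Qed.

Lemma model_del_edge (H G : sgraph) (x y : G) :
  model H (del_edge x y) -> model H G.
Proof.
case=> f [fS fC fA]; exists f; split=> //.
- move=> u v fu fuv; apply: (connect_map (f := id) _ (fC u v fu fuv)) => {fu fuv}u {}v /=.
  by move=> /andP[/= /andP[auv _] fe]; apply: connect1; rewrite /fibre_link /= auv.
- move=> a b /fA[u [v [fu fv /= /andP[auv _]]]].
  by exists u, v.
Qed.

Section Contraction.
Variables (G : sgraph) (x y : G).
Hypothesis adj_xy : adj x y.

Lemma contracted_neq : x != y.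
Proof. by apply/eqP=> xy; move: adj_xy; rewrite xy adj_irr. Qed.

Definition contract_proj (z : G) : contract x y :=
  insubd (Sub x contracted_neq : contract x y) z.

Lemma contract_projE z : val (contract_proj z) = if z == y then x else z.
Proof. by rewrite /contract_proj val_insubd; case: eqP. Qed.

Lemma contract_projK (u : contract x y) : contract_proj (val u) = u.
Proof. by apply: val_inj; rewrite contract_projE (negPf (valP u)). Qed.

Lemma adj_contract_proj u v : adj u v -> contract_proj u != contract_proj v ->
  adj (contract_proj u) (contract_proj v).
Proof.
move=> auv pne; rewrite /= /contract_adj /= pne /= !contract_projE.
case: (eqVneq u y) auv => [->|uy]; case: (eqVneq v y) => [->|vy] auv.
- by rewrite adj_irr in auv.
- by rewrite eqxx /= auv orbT.
- by rewrite eqxx /= [adj y u]adj_sym auv !orbT.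
- by rewrite auv.
Qed.

Lemma model_contract (H : sgraph) : model H (contract x y) -> model H G.
Proof.
case=> f [fS fC fA].
pose f' z := f (contract_proj z).
have f'E u : f' (val u) = f u by rewrite /f' contract_projK.
have xE : f' x = f' y.
  by rewrite /f'; congr f; apply: val_inj; rewrite !contract_projE eqxx; case: ifP.
have linkxy : fibre_link f' x y by rewrite /fibre_link /= adj_xy xE eqxx.
have linkyx : fibre_link f' y x by rewrite /fibre_link /= adj_sym adj_xy xE eqxx.
have toval z : connect (fibre_link f') z (val (contract_proj z)).
  by rewrite contract_projE; case: eqP => [->|_]; [apply: connect1|apply: connect0].
have ofval z : connect (fibre_link f') (val (contract_proj z)) z.
  by rewrite contract_projE; case: eqP => [->|_]; [apply: connect1|apply: connect0].
have lift u v : adj u v -> exists u' v',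
    [/\ adj u' v', contract_proj u' = u & contract_proj v' = v].
  move=> /= /andP[uv /or3P[auv|/andP[/eqP ux ayv]|/andP[/eqP vx ayu]]].
  - by exists (val u), (val v); rewrite !contract_projK.
  - exists y, (val v); rewrite ayv contract_projK; split=> //.
    by apply: val_inj; rewrite contract_projE eqxx.
  - exists (val u), y; rewrite adj_sym ayu contract_projK; split=> //.
    by apply: val_inj; rewrite contract_projE eqxx.
exists f'; split.
- by move=> a; have [u fu] := fS a; exists (val u); rewrite f'E.
- move=> u v fu fuv; apply: connect_trans (toval u) _.
  apply: connect_trans (ofval v).
  apply: (connect_map _ (fC _ _ fu fuv)) => {fu fuv} u' v' /andP[auv /eqP fe].
  have [u1 [v1 [a1 eu ev]]] := lift _ _ auv; rewrite -eu -ev.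
  apply: connect_trans (ofval u1) _; apply: connect_trans (toval v1).
  by apply: connect1; rewrite /fibre_link /= a1 /f' eu ev fe eqxx.
- move=> a b /fA[u [v [fu fv /lift[u1 [v1 [a1 eu ev]]]]]].
  by exists u1, v1; rewrite /f' eu ev.
Qed.

End Contraction.

Definition nbr (G : sgraph) (x : G) : {set G} := [set y | adj x y].
(** Ordered pairs count every edge twice, but their number is a plain sum of
    degrees. *)
Definition arcs (G : sgraph) : {set G * G} := [set p | adj p.1 p.2].

Lemma in_arcs (G : sgraph) (p : G * G) : (p \in arcs G) = adj p.1 p.2.
Proof. by rewrite inE. Qed.

Lemma card_arcs (G : sgraph) : #|arcs G| = \sum_(x : G) #|nbr x|.
Proof.
rewrite -sum1_card (eq_bigl (fun p : G * G => true && adj p.1 p.2)); last first.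
  by move=> p; rewrite inE.
rewrite -(pair_big_dep predT (fun x y : G => adj x y) (fun _ _ => 1)) /=.
by apply: eq_bigr => x _; rewrite -sum1_card; apply: eq_bigl => y; rewrite inE.
Qed.

Lemma set2_eq (T : finType) (x y u v : T) : [set u; v] = [set x; y] :> {set T} ->
  (u = x /\ v = y) \/ (u = y /\ v = x).
Proof.
move=> e; have ux : u \in [set x; y] by rewrite -e set21.
have vx : v \in [set x; y] by rewrite -e set22.
have xu : x \in [set u; v] by rewrite e set21.
have yu : y \in [set u; v] by rewrite e set22.
move: ux vx xu yu; rewrite !inE => /orP[]/eqP-> /orP[]/eqP->; rewrite ?orbb.
- by move=> _ /eqP->; left.
- by left.
- by right.
- by move=> /eqP-> _; left.
Qed.

Lemma del_edge_arcs (G : sgraph) (x y : G) : adj x y ->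
  #|arcs G| = #|arcs (del_edge x y)| + 2.
Proof.
move=> axy.
have xy : x != y by apply: contracted_neq.
have -> : arcs (del_edge x y) = arcs G :\: [set (x, y); (y, x)].
  apply/setP=> -[u v]; rewrite !inE /= /del_edge_adj /= !xpair_eqE andbC.
  congr (~~ _ && _); apply/eqP/idP => [/set2_eq[[-> ->]|[-> ->]]|]; rewrite ?eqxx ?orbT //.
  by case/orP=> /andP[/eqP-> /eqP->] //; rewrite finset.setUC.
rewrite -[LHS](cardsID [set (x, y); (y, x)]) addnC; congr (_ + _).
rewrite (setIidPr _); last first.
  by apply/subsetP=> p; rewrite !inE => /orP[]/eqP-> //=; rewrite adj_sym.
by rewrite cards2 xpair_eqE (negPf xy).
Qed.

(** Deleting the edges of [G] that do not come from [H], one at a time, turns a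
    bijective homomorphism into an isomorphism. *)
Lemma hom_bij_minor (H G : sgraph) (h : H -> G) : bijective h ->
  (forall a b, adj a b -> adj (h a) (h b)) -> minor H G.
Proof.
move=> bij_h; have [n] := ubnP #|arcs G|.
elim: n => // n IHn in G h bij_h * => ltn hom.
have [[a [b]] /andP[Ahab nAab]|iso] := pselect (exists a, exists b, adj (h a) (h b) && ~~ adj a b).
  apply: (minor_del_edge Ahab).
  apply: (IHn (del_edge (h a) (h b)) h) => //.
    by move: ltn; rewrite (del_edge_arcs Ahab); lia.
  move=> a' b' A'; rewrite /= /del_edge_adj /= hom //=; apply: contraNneq nAab => /set2_eq.
  by case=> -[/(bij_inj bij_h) <- /(bij_inj bij_h) <-] //; rewrite adj_sym.
apply: minor_iso; exists h => // a b; apply/idP/idP; last exact: hom.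
by move=> A; apply: contrapT => /negP nA; apply: iso; exists a, b; rewrite A.
Qed.

(** A vertex outside all branch sets can be deleted and an edge inside a branch
    set can be contracted, both without losing the model. When neither is
    possible the branch sets are singletons covering [G], because a connected
    set with two vertices contains an edge. *)
Theorem model_minor (H G : sgraph) : model H G -> minor H G.
Proof.
have [n] := ubnP #|G|; elim: n => // n IHn in G * => ltn [f [fS fC fA]].
have [[x fx]|all_some] := pselect (exists x, f x = None).
  apply: (@minor_del_vertex _ _ x); apply: IHn.
    rewrite card_sig (eq_card (B := predC1 x)) ?cardC1; last by move=> z; rewrite !inE.
    by have : 0 < #|G| by [apply/card_gt0P; exists x]; lia.
  have nx z : f z != None -> z \notin [set x].
    by move=> fz; rewrite inE; apply: contraNneq fz => ->; rewrite fx.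
  exists (fun u => f (val u)); split.
  - move=> a; have [z fz] := fS a.
    have z0 : z \notin [set x] by rewrite nx ?fz.
    by exists (Sub z z0).
  - move=> u v fu fuv; have /connectP[p] := fC _ _ fu fuv.
    elim: p u fu {fuv} => [|w p IHp] u fu /=; first by move=> _ /val_inj->.
    case/andP=> /andP[auw /eqP fuw] pp vl.
    have fw : f w != None by rewrite -fuw.
    apply: connect_trans (IHp (Sub w (nx w fw)) fw pp vl).
    by apply: connect1; rewrite /fibre_link /= /del_vertices_adj /= auw fuw eqxx.
  - move=> a b /fA[z [w [fz fw azw]]].
    have z0 : z \notin [set x] by rewrite nx ?fz.
    have w0 : w \notin [set x] by rewrite nx ?fw.
    by exists (Sub z z0), (Sub w w0).
have fN x : f x != None by apply/eqP=> fx; apply: all_some; exists x.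
have [[x [y]] /andP[axy /eqP fxy]|no_link] :=
  pselect (exists x, exists y, adj x y && (f x == f y)).
  apply: (minor_contract axy); apply: IHn.
    rewrite card_sig (eq_card (B := predC1 y)) ?cardC1; last by move=> z; rewrite !inE.
    by have : 0 < #|G| by [apply/card_gt0P; exists x]; lia.
  have fP z : f (val (contract_proj axy z)) = f z.
    by rewrite contract_projE; case: eqP => [->|].
  exists (fun u => f (val u)); split.
  - by move=> a; have [z fz] := fS a; exists (contract_proj axy z); rewrite fP.
  - move=> u v fu fuv; rewrite -(contract_projK axy u) -(contract_projK axy v).
    apply: (connect_map _ (fC _ _ fu fuv)) => z w /andP[azw /eqP fzw].
    have [->|ne] := eqVneq (contract_proj axy z) (contract_proj axy w); first exact: connect0.
    by apply: connect1; rewrite /fibre_link /= !fP fzw eqxx andbT; apply: adj_contract_proj.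
  - move=> a b ab; have [z [w [fz fw azw]]] := fA a b ab.
    exists (contract_proj axy z), (contract_proj axy w); rewrite !fP; split=> //.
    apply: adj_contract_proj => //; apply: contraTneq ab => /(congr1 (fun u => f (val u))).
    by rewrite !fP fz fw => -[->]; rewrite adj_irr.
have f_inj : injective f.
  move=> x y fxy; have /connectP[[|z p] /=] := fC _ _ (fN x) fxy; first by [].
  by case/andP=> /andP[axz fxz]; case: no_link; exists x, z; rewrite axz.
have [h fh] := fin_all_exists fS.
have fG x : exists a, f x = Some a.
  by have := fN x; case: (f x) => // a _; exists a.
have [g fg] := fin_all_exists fG.
apply: (hom_bij_minor (h := h)).
  exists g => x; last by apply: f_inj; rewrite fh fg.
  by apply: Some_inj; rewrite -fg fh.
move=> a b /fA[x [y [fx fy axy]]].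
by rewrite (f_inj (h a) x) ?fh // (f_inj (h b) y) ?fh.
Qed.

(** * Dense minors with many common neighbours *)

Lemma card_contract (G : sgraph) (x y : G) : #|contract x y| = #|G|.-1.
Proof.
by rewrite card_sig (eq_card (B := predC1 y)) ?cardC1 // => z; rewrite !inE.
Qed.

Lemma card_del_vertices (G : sgraph) (X : {set G}) : #|del_vertices X| = #|~: X|.
Proof. by rewrite card_sig; apply: eq_card => z; rewrite !inE. Qed.

Lemma card_del_vertex (G : sgraph) (x : G) : #|del_vertices [set x]| = #|G|.-1.
Proof. by rewrite card_del_vertices cardsC1. Qed.

Lemma nbr_del_vertices (G : sgraph) (X : {set G}) (u v : del_vertices X) :
  val @: (nbr u :&: nbr v) = (nbr (val u) :&: nbr (val v)) :\: X.
Proof.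
apply/setP=> z; apply/imsetP/idP => [[w]|].
  by rewrite !inE /= /del_vertices_adj /= => aw ->; rewrite (valP w) aw.
rewrite !inE => /andP[zX /andP[auz avz]]; exists (Sub z zX) => //.
by rewrite !inE /= /del_vertices_adj /= auz avz.
Qed.

Lemma arcs_del_vertex (G : sgraph) (x : G) :
  #|arcs G| <= #|arcs (del_vertices [set x])| + 2 * #|nbr x|.
Proof.
pose f (p : del_vertices [set x] * del_vertices [set x]) : G * G := (val p.1, val p.2).
have sub : arcs G \subset f @: arcs (del_vertices [set x]) :|:
   ((fun y => (x, y)) @: nbr x :|: (fun y => (y, x)) @: nbr x).
  apply/subsetP=> -[u v]; rewrite in_arcs /= => auv; rewrite !in_setU.
  have [ux|ux] := boolP (u \in [set x]).
    have ux' := set1P ux; subst u.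
    by rewrite [X in _ || (X || _)]imset_f ?orbT // inE.
  have [vx|vx] := boolP (v \in [set x]).
    have vx' := set1P vx; subst v.
    by rewrite [X in _ || (_ || X)](imset_f (fun y => (y, x))) ?orbT // inE adj_sym.
  apply/orP; left; apply/imsetP; exists (Sub u ux, Sub v vx) => //.
  by rewrite inE.
apply: leq_trans (subset_leq_card sub) _.
apply: leq_trans (leq_card_setU _ _) _; apply: leq_add; first exact: leq_imset_card.
apply: leq_trans (leq_card_setU _ _) _.
by rewrite mul2n -addnn leq_add // leq_imset_card.
Qed.

(** Contracting [xy] destroys that edge and merges the two edges that join each
    common neighbour to [x] and to [y]; every other edge survives. *)
Lemma arcs_contract (G : sgraph) (x y : G) (axy : adj x y) :
  #|arcs G| <= #|arcs (contract x y)| + 2 * #|nbr x :&: nbr y|.+1.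
Proof.
set C := nbr x :&: nbr y; set P := contract_proj axy.
pose f (p : G * G) := (P p.1, P p.2).
pose lost : {set G * G} := [set (x, y); (y, x)] :|:
   ((fun z => (y, z)) @: C :|: (fun z => (z, y)) @: C).
have card_lost : #|lost| <= 2 * #|C|.+1.
  apply: leq_trans (leq_card_setU _ _) _; rewrite mulnS; apply: leq_add.
    by rewrite cards2; case: (_ != _).
  apply: leq_trans (leq_card_setU _ _) _.
  by rewrite mul2n -addnn leq_add // leq_imset_card.
rewrite -(cardsID lost) addnC; apply: leq_add; last first.
  by apply: leq_trans card_lost; apply: subset_leq_card; apply: subsetIr.
have keep u v : (u, v) \in arcs G :\: lost ->
    [/\ adj u v, u = y -> adj x v = false, v = y -> adj x u = false,
        u = x -> v <> y & u = y -> v <> x].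
  rewrite !inE /= !negb_or => /andP[/andP[/andP[n1 n2] /andP[n3 n4]] auv].
  split=> // [uy|vy|ux vy|uy vx].
  - subst u; apply: contraNF n3 => axv; apply/imsetP; exists v => //.
    by rewrite !inE axv.
  - subst v; apply: contraNF n4 => axu; apply/imsetP; exists u => //.
    by rewrite !inE axu adj_sym.
  - by rewrite ux vy eqxx in n1.
  - by rewrite uy vx eqxx in n2.
have fin : {in arcs G :\: lost &, injective f}.
  move=> [u v] [u' v'] /keep[a1 b1 c1 d1 e1] /keep[a2 b2 c2 d2 e2].
  case=> /(congr1 val) + /(congr1 val); rewrite !contract_projE.
  have := adj_irr y; have := adj_sym u v; have := adj_sym u' v'.
  case: (eqVneq u y) => uy; case: (eqVneq v y) => vy;
    case: (eqVneq u' y) => uy'; case: (eqVneq v' y) => vy' ? ? ? ? ?; intuition congruence.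
rewrite -(card_in_imset fin); apply: subset_leq_card.
apply/subsetP=> _ /imsetP[[u v] /keep[a1 b1 c1 d1 e1] ->].
rewrite in_arcs /=; apply: adj_contract_proj => //.
apply/eqP=> /(congr1 val); rewrite !contract_projE.
have := adj_irr u.
by case: (eqVneq u y) => uy; case: (eqVneq v y) => vy ? ?; intuition congruence.
Qed.

(** The local information left by minimality of a minor subject to having at
    least [g n / 8] edges on [n] vertices (whence the factor 4 for arcs): no
    edge deletion, vertex deletion or edge contraction preserves the bound. *)
Definition contraction_critical (g : nat -> nat) (M : sgraph) : Prop :=
  [/\ g #|M| <= 4 * #|arcs M| < g #|M| + 8,
      forall x : M, g #|M| < g #|M|.-1 + 8 * #|nbr x|
    & forall x y : M, adj x y -> g #|M| < g #|M|.-1 + 8 * #|nbr x :&: nbr y|.+1].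

Lemma critical_minor (g : nat -> nat) (G : sgraph) : (forall n, 0 < n -> 0 < g n) ->
  0 < #|G| -> g #|G| <= 4 * #|arcs G| ->
  exists M : sgraph, [/\ forall H, model H M -> model H G, 0 < #|M| <= #|G|
    & contraction_critical g M].
Proof.
move=> g_gt0; have [n] := ubnP #|G|; elim: n => // n IHn in G *.
have [m] := ubnP #|arcs G|; elim: m => // m IHm in G *.
move=> ltm ltn G0 gG.
have [[x y] /[!in_arcs] /= axy] : exists p, p \in arcs G.
  by apply/card_gt0P; have := g_gt0 _ G0; lia.
have xy : x != y := contracted_neq axy.
have G1 : 1 < #|G|.
  by apply: leq_trans (max_card (mem [set x; y])); rewrite cards2 xy.
have smaller (G' : sgraph) : (forall H, model H G' -> model H G) -> #|G'| = #|G|.-1 ->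
    g #|G|.-1 <= 4 * #|arcs G'| -> exists M : sgraph,
    [/\ forall H, model H M -> model H G, 0 < #|M| <= #|G| & contraction_critical g M].
  move=> G'G cG' gG'; have [|||M [MG' M0 critM]] := IHn G'; rewrite ?cG' //; try lia.
  exists M; split; [by move=> H /MG'/G'G | lia | exact: critM].
have [[u gu]|no_vertex] := pselect (exists u : G, g #|G|.-1 + 8 * #|nbr u| <= g #|G|).
  apply: (smaller (del_vertices [set u])); last 2 first.
  - exact: card_del_vertex.
  - by have := arcs_del_vertex u; lia.
  - by move=> H; apply: model_del_vertices.
have [[u [v [auv gu]]]|no_contract] := pselect (exists u v : G,
    adj u v /\ g #|G|.-1 + 8 * #|nbr u :&: nbr v|.+1 <= g #|G|).
  apply: (smaller (contract u v)); last 2 first.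
  - exact: card_contract.
  - by have := arcs_contract auv; lia.
  - by move=> H; apply: model_contract.
have [le8|lt8] := leqP (g #|G| + 8) (4 * #|arcs G|).
  have cE := del_edge_arcs axy; have cV : #|del_edge x y| = #|G| by [].
  have [||||M [MG' M0 critM]] := IHm (del_edge x y); rewrite ?cV //; try lia.
   by exists M; split=> // H /MG'; apply: model_del_edge.
exists G; split=> //; first by rewrite G0 leqnn.
split; rewrite ?gG //.
- by move=> u; rewrite ltnNge; apply/negP=> gu; apply: no_vertex; exists u.
- by move=> u v auv; rewrite ltnNge; apply/negP=> gu; apply: no_contract; exists u, v.
Qed.

Lemma exists_low_degree (G : sgraph) (a b : nat) :
  a * #|arcs G| < b * #|G| -> exists x : G, a * #|nbr x| < b.
Proof.
move=> lt_arcs; apply: contrapT => no_low.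
suff : b * #|G| <= a * #|arcs G| by lia.
rewrite card_arcs big_distrr /= mulnC -sum_nat_const; apply: leq_sum => x _.
by rewrite leqNgt; apply/negP=> low; apply: no_low; exists x.
Qed.

Lemma degree_lt_card (G : sgraph) (x : G) : #|nbr x| < #|G|.
Proof.
rewrite -cardsT; apply: proper_card; apply/properP; split; first exact: subsetT.
by exists x; rewrite ?inE ?adj_irr.
Qed.

(** With [k = 16 h], the first minimal minor is taken for the threshold [k n];
    the neighbourhood [U] of a vertex of small degree has order at most [2 k]
    and minimum degree at least [k], hence enough edges for the second threshold
    [n (n + 2 k) / 8]. For the second minimal minor [N], of order [n], the
    average degree is about [(n + 2 k) / 4], while each edge has at least about
    [(n + k) / 4] common neighbours. So the neighbourhood [W] of a vertex of
    small degree has order [m] about [(n + 2 k) / 4] and minimum degree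
    about [(n + k) / 4]; two vertices of [W] thus have at least about
    [2 (n + k) / 4 - m = n / 4] common neighbours. This is of order [k] because
    the vertices of [N] have degree at least about [(n + k) / 4], which forces
    [n] to be at least about [k / 3]. *)
Lemma dense_neighbourhood_minor (h : nat) (G : sgraph) : 12 <= h -> 0 < #|G| ->
  32 * h * #|G| <= #|arcs G| ->
  exists M : sgraph, [/\ forall H, model H M -> model H G,
    0 < #|M|, #|M| <= 32 * h & forall x y : M, h <= #|nbr x :&: nbr y|].
Proof.
move=> h12 G0 arcsG.
have [||M [MG /andP[M0 _] [/andP[_ arcsM] degM codegM]]] :=
    @critical_minor (fun n => 128 * h * n) G _ G0 _; first by move=> n; nia.
  by rewrite -mulnA; lia.
cbv beta in arcsM, degM, codegM.
have stepM : 128 * h * #|M| = 128 * h * #|M|.-1 + 128 * h by rewrite -mulnSr prednK.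
have {}degM (x : M) : 16 * h < #|nbr x|.
  by have := degM x; rewrite stepM ltn_add2l; lia.
have M1 : 1 < #|M|.
  by have /card_gt0P[x _] := M0; have := degree_lt_card x; have := degM x; lia.
have [|v dv] := @exists_low_degree M 1 (32 * h).+1.
  have quarter : 128 * h * #|M| = 4 * (32 * h * #|M|) by rewrite !mulnA.
  by rewrite quarter in arcsM; rewrite mul1n mulSn; lia.
pose X := ~: nbr v; pose U := del_vertices X.
have cU : #|U| = #|nbr v| by rewrite card_del_vertices setCK.
have degU (u : U) : 16 * h <= #|nbr u|.
  have avu : adj v (val u) by have := valP u; rewrite !inE negbK.
  have := codegM _ _ avu.
  have := congr1 (fun A : {set M} => #|A|) (nbr_del_vertices u u).
  rewrite card_imset; last exact: val_inj.
  by rewrite !finset.setIid setDE setCK (finset.setIC (nbr v)) => ->; nia.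
have U0 : 0 < #|U| by rewrite cU; have := degM v; nia.
have arcsU : 16 * h * #|U| <= #|arcs U|.
  by rewrite card_arcs mulnC -sum_nat_const; apply: leq_sum => u _; apply: degU.
have [||N [NU /andP[N0 leNU] [/andP[_ arcsN] degN codegN]]] :=
    @critical_minor (fun n => n * (n + 32 * h)) U _ U0 _; first by move=> n; nia.
  by rewrite cU in arcsU *; nia.
cbv beta in arcsN, degN, codegN.
have [|w dw] := @exists_low_degree N 4 (#|N| + 32 * h + 8); first by nia.
pose Y := ~: nbr w; pose W := del_vertices Y.
have cW : #|W| = #|nbr w| by rewrite card_del_vertices setCK.
have dwN := degree_lt_card w.
have cNU : #|N| <= 32 * h by rewrite cU in leNU; nia.
have := degN w => dw2.
have degW (u : W) : 2 * #|N| + 32 * h <= 8 * #|nbr u| + 8.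
  have awu : adj w (val u) by have := valP u; rewrite !inE negbK.
  have := codegN _ _ awu.
  have := congr1 (fun A : {set N} => #|A|) (nbr_del_vertices u u).
  rewrite card_imset; last exact: val_inj.
  by rewrite !finset.setIid setDE setCK (finset.setIC (nbr w)) => ->; nia.
exists W; split.
- by move=> H /model_del_vertices/NU/model_del_vertices/MG.
- by rewrite cW; nia.
- by rewrite cW; nia.
- move=> x y; have := cardsUI (nbr x) (nbr y); have := degW x; have := degW y.
  have : #|nbr x :|: nbr y| <= #|W| by apply: max_card.
  by rewrite cW; nia.
Qed.

(** * Greedy branch sets *)

Lemma exists_below_average (T : finType) (A : {set T}) (F : T -> nat) (c : nat) :
  0 < #|A| -> \sum_(a in A) F a <= #|A| * c -> exists2 a, a \in A & F a <= c.
Proof.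
move=> A0 sumF; apply: contrapT => no_a.
suff : #|A| * c.+1 <= \sum_(a in A) F a by nia.
rewrite -sum_nat_const; apply: leq_sum => a Aa; rewrite ltnNge.
by apply/negP => Fa; apply: no_a; exists a.
Qed.

Section BranchSets.
Variable G : sgraph.
Implicit Types (A B X U : {set G}) (Bs : seq {set G}).

Definition undominated (A : {set G}) : {set G} :=
  [set w | [forall a in A, ~~ adj a w]].

Definition touch (A B : {set G}) : bool :=
  [exists a in A, exists b in B, adj a b].

Definition connected_set (A : {set G}) : Prop :=
  {in A &, forall x y, connect [rel u v | [&& adj u v, u \in A & v \in A]] x y}.

Lemma touchP A B : reflect (exists a b, [/\ a \in A, b \in B & adj a b]) (touch A B).
Proof.
apply: (iffP existsP) => [[a /andP[Aa /existsP[b /andP[Bb ab]]]]|[a [b [Aa Bb ab]]]].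
  by exists a, b.
by exists a; rewrite Aa; apply/existsP; exists b; rewrite Bb.
Qed.

Lemma touch_sym A B : touch A B = touch B A.
Proof.
by apply/touchP/touchP => -[a [b [Aa Bb ab]]]; exists b, a; rewrite adj_sym.
Qed.

Lemma touchS A A' B : A \subset A' -> touch A B -> touch A' B.
Proof. by move=> /subsetP sub /touchP[a [b [/sub Aa Bb ab]]]; apply/touchP; exists a, b. Qed.

Lemma touch_undominated A B : ~~ (A \subset undominated B) -> touch A B.
Proof.
case/subsetPn=> a Aa; rewrite inE negb_forall => /existsP[b].
rewrite negb_imply negbK => /andP[Bb ba].
by apply/touchP; exists a, b; rewrite adj_sym.
Qed.

Lemma undominatedS A A' : A \subset A' -> undominated A' \subset undominated A.
Proof.
move=> /subsetP sub; apply/subsetP=> w; rewrite !inE => /forallP un.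
by apply/forallP=> a; apply/implyP=> /sub; apply/implyP.
Qed.

Lemma undominated0 : undominated set0 = setT.
Proof. by apply/setP=> w; rewrite !inE; apply/forallP=> a; rewrite inE. Qed.

Lemma undominatedU1 a A : undominated (a |: A) = undominated A :\: nbr a.
Proof.
apply/setP=> w; rewrite !inE; apply/forallP/andP => [un|[naw /forallP un] b].
  split; first by have := un a; rewrite setU11.
  by apply/forallP=> b; apply/implyP=> Ab; have := un b; rewrite inE Ab orbT.
by rewrite !inE; apply/implyP=> /orP[/eqP->|] //; apply/implyP.
Qed.

Lemma connected_set1 x : connected_set [set x].
Proof. by move=> y z /set1P-> /set1P->; apply: connect0. Qed.

Lemma connected_setU1 A a c : connected_set A -> a \in A -> adj a c ->
  connected_set (c |: A).
Proof.
move=> conA Aa aac.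
have lift x y : x \in A -> y \in A ->
    connect [rel u v | [&& adj u v, u \in c |: A & v \in c |: A]] x y.
  move=> Ax Ay; apply: (connect_map (f := id) _ (conA x y Ax Ay)) => u v /= /and3P[uv Au Av].
  by apply: connect1; rewrite /= uv !inE Au Av !orbT.
have ca : connect [rel u v | [&& adj u v, u \in c |: A & v \in c |: A]] c a.
  by apply: connect1; rewrite /= adj_sym aac !inE eqxx Aa orbT.
have ac : connect [rel u v | [&& adj u v, u \in c |: A & v \in c |: A]] a c.
  by apply: connect1; rewrite /= aac !inE eqxx Aa orbT.
move=> x y /setU1P[->|Ax] /setU1P[->|Ay].
- exact: connect0.
- exact: connect_trans ca (lift _ _ Aa Ay).
- exact: connect_trans (lift _ _ Ax Aa) ac.
- exact: lift.
Qed.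

Variable h : nat.
Hypotheses (h_gt0 : 0 < h) (cardG : #|G| <= 32 * h)
  (codeg : forall x y : G, h <= #|nbr x :&: nbr y|).

Section Avoid.
Variable X : {set G}.
Hypothesis cardX : 2 * #|X| <= h.

Lemma common_neighbour (x y : G) : exists c, [/\ c \notin X, adj x c & adj y c].
Proof.
have /subsetPn[c] : ~~ (nbr x :&: nbr y \subset X).
  by apply/negP=> /subset_leq_card; have := codeg x y; lia.
by rewrite !inE => /andP[xc yc] nX; exists c.
Qed.

(** With at most [h / 2] vertices used, every vertex still sees at least [h / 2]
    unused ones, out of at most [32 h]. *)
Lemma free_degree (w : G) : #|~: X| <= 64 * #|nbr w :\: X|.
Proof.
have := codeg w w; rewrite finset.setIid -(cardsID X (nbr w)).
have := subset_leq_card (subsetIr (nbr w) X).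
have : #|~: X| <= #|G| by apply: max_card.
by lia.
Qed.

Lemma half_free (x : G) : #|G| <= 2 * #|~: X|.
Proof.
have := codeg x x; have : #|nbr x :&: nbr x| <= #|G| by apply: max_card.
by have := cardsC X; lia.
Qed.

(** On average over the unused vertices, picking one dominates at least one in 64
    of the vertices of [U]. *)
Lemma sum_undominated U :
  64 * (\sum_(a in ~: X) #|U :\: nbr a|) <= 63 * (#|~: X| * #|U|).
Proof.
have -> : \sum_(a in ~: X) #|U :\: nbr a| = \sum_(w in U) #|~: X :\: nbr w|.
  transitivity (\sum_(a in ~: X) \sum_(w in U) (~~ adj a w : nat)).
    apply: eq_bigr => a _; rewrite -sum1_card.
    rewrite (eq_bigl (fun w => (w \in U) && ~~ adj a w)); last first.
      by move=> w; rewrite !inE andbC.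
    by rewrite big_mkcondr; apply: eq_bigr => w _; case: adj.
  rewrite exchange_big; apply: eq_bigr => w _ /=; rewrite -sum1_card.
  rewrite [RHS](eq_bigl (fun a => (a \in ~: X) && ~~ adj a w)); last first.
    by move=> a; rewrite !inE adj_sym andbC.
  by rewrite big_mkcondr; apply: eq_bigr => a _; case: adj.
rewrite mulnA [X in _ <= X]mulnC -sum_nat_const big_distrr /=; apply: leq_sum => w _.
have := free_degree w; have := cardsID (nbr w) (~: X).
have -> : ~: X :&: nbr w = nbr w :\: X by rewrite setDE finset.setIC.
by lia.
Qed.

(** On average over the unused vertices, at most one in [g] of the sets of [Bs]
    contains the picked vertex, since each of them is a proportion at most
    [1 / (2 g)] of [G] and at least half of [G] is unused. *)
Lemma sum_count (Bs : seq {set G}) (g : nat) :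
  {in Bs, forall B, 2 * (g * #|B|) <= #|G|} ->
  g * (\sum_(a in ~: X) count (fun B => a \in B) Bs) <= #|~: X| * size Bs.
Proof.
elim: Bs => [|B Bs IHBs] small /=; first by rewrite big1 // muln0.
rewrite big_split mulnDr mulnS /= leq_add //; last first.
  by apply: IHBs => B' B's; apply: small; rewrite inE B's orbT.
have := small B (mem_head _ _).
have [->|/set0Pn[x _]] := eqVneq B set0.
  by rewrite big1 ?muln0 // => a _; rewrite inE.
have := half_free x.
suff : \sum_(a in ~: X) (a \in B) <= #|B| by nia.
rewrite -big_mkcondr sum1_card subset_leq_card //.
by apply/subsetP=> a /andP[].
Qed.

(** Both quantities to be made small, the number of undominated vertices and the
    number of sets of [Bs] that contain everything picked so far, shrink on
    average by the factors [63 / 64] and [1 / g] when one more vertex is picked.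
    A weighted sum of the two, rescaled by these factors, therefore does not
    increase for a suitable choice, which handles both at once. The rescaling
    is cleared of denominators. *)
Lemma greedy_pick (g l w1 w2 : nat) (U : {set G}) (Bs : seq {set G}) :
  0 < #|~: X| -> {in Bs, forall B, 2 * (g * #|B|) <= #|G|} ->
  exists A : {set G}, [/\ #|A| <= l, [disjoint A & X], 0 < l -> A != set0 &
    w1 * 64 ^ l * #|U :&: undominated A| + w2 * g ^ l * count (fun B => A \subset B) Bs
      <= w1 * 63 ^ l * #|U| + w2 * size Bs].
Proof.
move=> freeX; elim: l w1 w2 U Bs => [|l IHl] w1 w2 U Bs small.
  exists set0; split; rewrite ?cards0 //; first by rewrite disjoints_subset sub0set.
  by rewrite undominated0 finset.setIT !expn0 !muln1 leq_add2l leq_mul2l count_size orbT.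
have [a Xa le_a] : exists2 a, a \in ~: X &
    64 * (63 ^ l * w1) * #|U :\: nbr a| + g * w2 * count (fun B => a \in B) Bs
     <= 63 * (63 ^ l * w1) * #|U| + w2 * size Bs.
  apply: exists_below_average => //.
  rewrite big_split /= -!big_distrr /=.
  have /(leq_mul (leqnn (63 ^ l * w1))) := sum_undominated U.
  have /(leq_mul (leqnn w2)) := sum_count small.
  by nia.
have [|A [cA dA _ leA]] := IHl (64 * w1) (g * w2) (U :\: nbr a)
    (filter (fun B : {set G} => a \in B) Bs).
  by move=> B; rewrite mem_filter => /andP[_]; apply: small.
exists (a |: A); split.
- by rewrite cardsU1; case: (_ \in _); rewrite ?add1n ?add0n //; lia.
- rewrite disjoints_subset subUset sub1set Xa -disjoints_subset; exact: dA.
- by move=> _; apply/set0Pn; exists a; rewrite setU11.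
- rewrite undominatedU1 (_ : U :&: _ = (U :\: nbr a) :&: undominated A); last first.
    by rewrite !setDE finset.setIA [RHS]finset.setIAC.
  rewrite (eq_count (a2 := fun B => (A \subset B) && (a \in B))); last first.
    by move=> B; rewrite subUset sub1set andbC.
  rewrite -count_filter.
  by move: leA le_a; rewrite size_filter !expnS; lia.
Qed.

(** The weights [size Bs + 1] and [63 ^ l * #|G|] give the two terms nearly equal
    initial values, so that bounding each term by the whole sum loses a factor 2. *)
Lemma dominating_pick (g l : nat) (Bs : seq {set G}) :
  0 < #|~: X| -> {in Bs, forall B, 2 * (g * #|B|) <= #|G|} ->
  exists A : {set G}, [/\ #|A| <= l, [disjoint A & X], 0 < l -> A != set0,
    64 ^ l * #|undominated A| <= 2 * 63 ^ l * #|G| &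
    g ^ l * count (fun B => A \subset B) Bs <= 2 * (size Bs).+1].
Proof.
move=> freeX small.
have [A [cA dA A0 leA]] := greedy_pick l (size Bs).+1 (63 ^ l * #|G|) setT freeX small.
exists A; split=> //; move: leA; rewrite finset.setTI cardsT.
  set u := #|undominated A|; set v := count _ _; set n := #|G|; move=> leA.
  have : (size Bs).+1 * (64 ^ l * u) <= (size Bs).+1 * (2 * 63 ^ l * n) by nia.
  by rewrite leq_pmul2l.
set u := #|undominated A|; set v := count _ _; set n := #|G|; move=> leA.
have n0 : 0 < 63 ^ l * n.
  by rewrite muln_gt0 expn_gt0 /=; apply: leq_trans freeX (max_card _).
have : 63 ^ l * n * (g ^ l * v) <= 63 ^ l * n * (2 * (size Bs).+1) by nia.
by rewrite leq_pmul2l.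
Qed.

(** Each new vertex is attached through a common neighbour with a fixed vertex
    of [A]. *)
Lemma connected_superset (A : {set G}) (s : seq G) :
  connected_set A -> A != set0 -> [disjoint A & X] -> {in s, forall x, x \notin X} ->
  exists A' : {set G}, [/\ connected_set A', A \subset A', {subset s <= A'},
    [disjoint A' & X] & #|A'| <= #|A| + 2 * size s].
Proof.
move=> conA A0 dA; elim: s => [|y s IHs] sX.
  by exists A; split; rewrite ?addn0.
have [|A1 [con1 sub1 s1 d1 c1]] := IHs.
  by move=> x xs; apply: sX; rewrite inE xs orbT.
have [a Aa] := set0Pn _ A0.
have [c [cX ac yc]] := common_neighbour a y.
exists (y |: (c |: A1)); split.
- apply: connected_setU1 (setU11 c A1) _; last by rewrite adj_sym.
  by apply: connected_setU1 con1 (subsetP sub1 a Aa) ac.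
- by apply: subset_trans sub1 _; apply: subset_trans (subsetU1 _ _) (subsetU1 _ _).
- by move=> x; rewrite !inE => /orP[->|/s1->] //; rewrite !orbT.
- by rewrite disjoints_subset !subUset !sub1set !inE cX sX ?mem_head -?disjoints_subset.
- by rewrite !cardsU1; do 2!case: (_ \notin _) => /=; lia.
Qed.

Lemma touching_superset (A : {set G}) (Bs : seq {set G}) :
  connected_set A -> A != set0 -> [disjoint A & X] -> {in Bs, forall B, B != set0} ->
  exists A' : {set G}, [/\ connected_set A', A \subset A',
    {in Bs, forall B, touch A' B}, [disjoint A' & X] & #|A'| <= #|A| + size Bs].
Proof.
move=> conA A0 dA; elim: Bs => [|B Bs IHBs] nBs.
  by exists A; split; rewrite ?addn0.
have [|A1 [con1 sub1 t1 d1 c1]] := IHBs.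
  by move=> B' B's; apply: nBs; rewrite inE B's orbT.
have [a Aa] := set0Pn _ A0; have [b Bb] := set0Pn _ (nBs B (mem_head _ _)).
have [c [cX ac bc]] := common_neighbour a b.
exists (c |: A1); split.
- by apply: connected_setU1 con1 (subsetP sub1 a Aa) ac.
- exact: subset_trans sub1 (subsetU1 _ _).
- move=> B'; rewrite inE => /orP[/eqP->|/t1]; last by apply: touchS; apply: subsetU1.
  by apply/touchP; exists c, b; rewrite setU11 adj_sym.
- by rewrite disjoints_subset !subUset !sub1set !inE cX -?disjoints_subset.
- by rewrite !cardsU1; case: (_ \notin _) => /=; lia.
Qed.

(** The vertices picked greedily, a common neighbour for each of them to make the
    set connected, and one common neighbour for each of the [v] sets of [Bs] that
    would otherwise not be touched: a set with a vertex outside [undominated B]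
    already touches [B]. *)
Lemma branch_set (g l : nat) (Bs : seq {set G}) : 0 < #|G| -> 0 < l ->
  {in Bs, forall B, B != set0 /\ 2 * (g * #|undominated B|) <= #|G|} ->
  exists (A : {set G}) (v : nat), [/\ A != set0, connected_set A, [disjoint A & X],
    {in Bs, forall B, touch A B} &
    [/\ 64 ^ l * #|undominated A| <= 2 * 63 ^ l * #|G|,
       #|A| <= 2 * l + v, v <= size Bs & g ^ l * v <= 2 * (size Bs).+1]].
Proof.
move=> G0 l0 small.
have freeX : 0 < #|~: X| by have /card_gt0P[x _] := G0; have := half_free x; lia.
have [|A [cA dA A0 uA vA]] := @dominating_pick g l [seq undominated B | B <- Bs] freeX.
  by move=> _ /mapP[B Bin ->]; have [] := small B Bin.
have [a Aa] := set0Pn _ (A0 l0).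
have outX z : z \in A -> z \notin X by move=> /(disjointFr dA) ->.
have [||||A1 [con1 sub1 s1 d1 c1]] := @connected_superset [set a] (enum (A :\ a)).
- exact: connected_set1.
- by apply/set0Pn; exists a; rewrite set11.
- by rewrite disjoints_subset sub1set inE outX.
- by move=> x; rewrite mem_enum !inE => /andP[_ /outX].
have subA : A \subset A1.
  apply/subsetP=> z Az; have [->|za] := eqVneq z a; first by rewrite (subsetP sub1) ?set11.
  by apply: s1; rewrite mem_enum !inE za.
pose bad := filter (fun B => A \subset undominated B) Bs.
have [||||A2 [con2 sub2 t2 d2 c2]] := @touching_superset A1 bad => //.
- by apply/set0Pn; exists a; apply: (subsetP subA).
- by move=> B; rewrite mem_filter => /andP[_ /small[]].
have subA2 := subset_trans subA sub2.
exists A2, (size bad); split=> //.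
- by apply/set0Pn; exists a; apply: (subsetP subA2).
- move=> B Bin; have [bB|gB] := boolP (A \subset undominated B).
    by apply: t2; rewrite mem_filter bB.
  by apply: touchS subA2 _; apply: touch_undominated.
- move: vA; rewrite size_map count_map size_filter => vA; split=> //.
  + by apply: leq_trans uA; rewrite leq_mul2l subset_leq_card ?orbT ?undominatedS.
  + move: c1 c2; rewrite -cardE cards1 size_filter.
    have := cardsD1 a A; rewrite Aa.
    by lia.
  + exact: count_size.
Qed.

End Avoid.

Section Placement.
Variable H : sgraph.
Implicit Types (vs ss : seq H) (F : H -> {set G}).

Definition used F vs : {set G} := [set x | has (fun v => x \in F v) vs].

Definition placed F vs : Prop :=
  [/\ {in vs, forall v, F v != set0 /\ connected_set (F v)},
      {in vs &, forall v w, v != w -> [disjoint F v & F w]}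
    & {in vs &, forall v w, adj v w -> touch (F v) (F w)}].

Definition place F (v : H) (A : {set G}) : H -> {set G} :=
  fun w => if w == v then A else F w.

Lemma place_old F v A vs : v \notin vs -> {in vs, forall w, place F v A w = F w}.
Proof. by move=> nv w wvs; rewrite /place; case: eqP => // wv; rewrite -wv wvs in nv. Qed.

Lemma card_used_place F v A vs : v \notin vs ->
  #|used (place F v A) (v :: vs)| <= #|A| + #|used F vs|.
Proof.
move=> nv; apply: leq_trans (leq_card_setU _ _); apply: subset_leq_card; apply/subsetP=> x.
rewrite !inE /= {1}/place eqxx => /orP[-> //|/hasP[w wvs]]; rewrite (place_old _ _ nv) // => Fx.
by apply/orP; right; apply/hasP; exists w.
Qed.

Lemma disjoint_used F vs A w : [disjoint A & used F vs] -> w \in vs -> [disjoint A & F w].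
Proof.
move=> dA wvs; apply: disjointWr dA; apply/subsetP=> z Fz.
by rewrite inE; apply/hasP; exists w.
Qed.

Lemma placed_cons F vs v A : placed F vs -> v \notin vs -> A != set0 ->
  connected_set A -> [disjoint A & used F vs] ->
  {in vs, forall w, adj v w -> touch A (F w)} -> placed (place F v A) (v :: vs).
Proof.
move=> [F1 F2 F3] nv A0 conA dA tA; have old := place_old F A nv.
have new : place F v A v = A by rewrite /place eqxx.
split.
- by move=> w; rewrite inE => /orP[/eqP->|wvs]; rewrite ?new ?old //; apply: F1.
- move=> w1 w2; rewrite !inE => /orP[/eqP->|w1vs] /orP[/eqP->|w2vs]; rewrite ?eqxx ?new ?old //.
  + by move=> _; apply: disjoint_used dA w2vs.
  + by move=> _; rewrite disjoint_sym; apply: disjoint_used dA w1vs.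
  + exact: F2.
- move=> w1 w2; rewrite !inE => /orP[/eqP->|w1vs] /orP[/eqP->|w2vs]; rewrite ?adj_irr ?new ?old //.
  + exact: tA.
  + by rewrite adj_sym touch_sym; apply: tA.
  + exact: F3.
Qed.

Lemma placed_model F vs : (forall v, v \in vs) -> placed F vs -> model H G.
Proof.
move=> all_vs [F1 F2 F3].
pose f x := [pick v | x \in F v].
have fP x v : x \in F v -> f x = Some v.
  rewrite /f; case: pickP => [w xw xv|/(_ v) -> //].
  have [-> //|wv] := eqVneq w v.
  by rewrite (disjointFr (F2 w v (all_vs w) (all_vs v) wv) xw) in xv.
have fE x v : f x = Some v -> x \in F v.
  by rewrite /f; case: pickP => // w xw [<-].
exists f; split.
- by move=> v; have [/set0Pn[x xv] _] := F1 v (all_vs v); exists x; apply: fP.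
- move=> x y; case fx : (f x) => [v|//] _ /esym fy.
  have [_ con] := F1 v (all_vs v).
  apply: (connect_map (f := id) _ (con x y (fE _ _ fx) (fE _ _ fy))) => a b /and3P[ab av bv].
  by apply: connect1; rewrite /fibre_link /= ab (fP _ _ av) (fP _ _ bv) eqxx.
- move=> v w /(F3 v w (all_vs v) (all_vs w))/touchP[x [y [xv yw xy]]].
  by exists x, y; rewrite (fP _ _ xv) (fP _ _ yw).
Qed.

(** [L] picks are enough to leave less than one vertex undominated, and such a
    branch set touches every nonempty set. *)
Lemma place_dominating (L : nat) (ss : seq H) : 0 < #|G| -> 0 < L ->
  2 * 63 ^ L * #|G| < 64 ^ L -> uniq ss -> 2 * (2 * L * size ss) <= h ->
  exists F, [/\ placed F ss, {in ss, forall v, undominated (F v) = set0}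
    & #|used F ss| <= 2 * L * size ss].
Proof.
move=> G0 L0 LP; elim: ss => [|v ss IHss] /=.
  move=> _ _; exists (fun _ => set0); split; [by split | by [] |].
  by rewrite muln0 leqn0 cards_eq0; apply/eqP/setP=> x; rewrite !inE.
case/andP=> nv us room.
have [|F [plF undF cF]] := IHss us; first by nia.
have [||A [w [A0 conA dA _ [uA cA wA _]]]] := @branch_set (used F ss) _ 0 L [::] G0 L0.
- by nia.
- by [].
have undA : undominated A = set0.
  apply/eqP; rewrite -cards_eq0 -leqn0 -ltnS.
  have := leq_ltn_trans uA LP; rewrite -[X in _ < X]muln1 ltn_pmul2l //.
  by rewrite expn_gt0.
exists (place F v A); split.
- apply: placed_cons => // w' w'ss _; apply: touch_undominated.
  by rewrite undF // subset0.
- by move=> w'; rewrite inE /place; case: eqP => //= _ /undF.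
- by apply: leq_trans (card_used_place _ _ nv) _; move: cA wA => /= cA wA; nia.
Qed.

Fixpoint back_edges vs : nat :=
  if vs is v :: vs' then count (adj v) vs' + back_edges vs' else 0.

(** A vertex with [b] neighbours already placed costs [2 l] vertices plus at most
    [2 (b + 1) / g ^ l] repairs, so the total number of repairs is governed by
    the number of edges among [vs]. Adjacency with [ss] comes for free, its
    branch sets being dominating. The assumption on [l] makes the undominated
    part of every new branch set as small as the next step requires. *)
Lemma place_sparse (l g c0 : nat) (F0 : H -> {set G}) (ss vs : seq H) :
  0 < #|G| -> 0 < l -> 4 * g * 63 ^ l <= 64 ^ l ->
  placed F0 ss -> {in ss, forall v, undominated (F0 v) = set0} -> #|used F0 ss| <= c0 ->
  uniq (vs ++ ss) ->
  2 * (g ^ l * (c0 + 2 * l * size vs) + 2 * (back_edges vs + size vs)) <= g ^ l * h ->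
  0 < g ->
  exists F, [/\ placed F (vs ++ ss), {in ss, forall v, undominated (F v) = set0},
    {in vs, forall v, 2 * (g * #|undominated (F v)|) <= #|G|}
    & g ^ l * #|used F (vs ++ ss)| <=
      g ^ l * (c0 + 2 * l * size vs) + 2 * (back_edges vs + size vs)].
Proof.
move=> G0 l0 lP pl0 und0 c0P + + g0; elim: vs => [|v vs IHvs] /=.
  by move=> _ _; exists F0; split=> //; rewrite !muln0 !addn0 leq_mul2l c0P orbT.
case/andP=> nv us room.
have gl0 : 0 < g ^ l by rewrite expn_gt0 g0.
have [|F [plF undF smallF cF]] := IHvs us; first by nia.
have room' : 2 * #|used F (vs ++ ss)| <= h by nia.
have [|A [w [A0 conA dA tA [uA cA _ wA]]]] :=
  @branch_set (used F (vs ++ ss)) room' g l [seq F u | u <- vs & adj v u] G0 l0.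
  move=> B /mapP[u + ->]; rewrite mem_filter => /andP[_ uvs].
  have [F1 _ _] := plF; have [] := F1 u; first by rewrite mem_cat uvs.
  by split=> //; apply: smallF.
rewrite size_map size_filter in wA.
exists (place F v A); split.
- apply: placed_cons => // u; rewrite mem_cat => /orP[uvs|uss] vu.
    by apply: tA; apply/mapP; exists u => //; rewrite mem_filter vu.
  by apply: touch_undominated; rewrite undF // subset0.
- by move=> u uss; rewrite (place_old _ _ nv) ?undF // mem_cat uss orbT.
- move=> u; rewrite inE /place; case: eqP => [_ _|_ /= uvs]; last exact: smallF.
  have : 63 ^ l * (2 * (g * #|undominated A|)) <= 63 ^ l * #|G| by nia.
  by rewrite leq_pmul2l // expn_gt0.
- have /(leq_mul (leqnn (g ^ l))) := card_used_place F A nv.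
  have := leq_mul (leqnn (g ^ l)) cA; move: cF wA => /=.
  rewrite !mulnDr !mulnS !mulnDr.
  move: #|used (place F v A) _| #|used F _| #|A| (count _ _) (g ^ l) (size vs)
    (back_edges vs) => *.
  by lia.
Qed.

End Placement.
End BranchSets.

(** * Embedding in a graph with many edges *)

Lemma sum_back_edges (H : sgraph) (vs : seq H) :
  \sum_(v <- vs) count (adj v) vs = 2 * back_edges vs.
Proof.
elim: vs => [|v vs IHvs]; first by rewrite big_nil.
rewrite big_cons /= adj_irr (eq_bigr (fun w => adj w v + count (adj w) vs)) //.
rewrite big_split /= IHvs (_ : \sum_(w <- vs) adj w v = count (adj v) vs); first by lia.
rewrite -sum1_count [RHS]big_mkcond /=; apply: eq_bigr => w _.
by rewrite adj_sym; case: adj.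
Qed.

Lemma back_edges_del_vertices (H : sgraph) (S : {set H}) :
  2 * back_edges [seq val u | u <- enum (del_vertices S)] = #|arcs (del_vertices S)|.
Proof.
rewrite -sum_back_edges big_map card_arcs big_enum /=; apply: eq_bigr => u _.
rewrite count_map -size_filter cardE /enum_mem -enumT /=; congr size.
rewrite /enum_mem -filter_predI; apply: eq_filter => v /=.
by rewrite !inE andbT.
Qed.

(** [(1 + 1 / a) ^ (a + 1) >= 2], by Bernoulli's inequality. *)
Lemma double_expn (a : nat) : 2 * a ^ a.+1 <= a.+1 ^ a.+1.
Proof.
have bernoulli j : a ^ j.+1 + j.+1 * a ^ j <= a.+1 ^ j.+1.
  elim: j => [|j IHj]; first by rewrite !expn1 expn0; lia.
  rewrite [a.+1 ^ _]expnS; apply: leq_trans (leq_mul (leqnn _) IHj).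
  by rewrite [a ^ j.+2]expnS [a ^ j.+1]expnS; nia.
by apply: leq_trans (bernoulli a); rewrite [a ^ a.+1]expnS; nia.
Qed.

Lemma double_expn_iter (a j : nat) : 2 ^ j * a ^ (a.+1 * j) <= a.+1 ^ (a.+1 * j).
Proof.
rewrite (expnM a) (expnM a.+1) -expnMn.
by case: j => // j; rewrite leq_exp2r ?double_expn.
Qed.

(** The branch sets of [S] are obtained from [64 q] picks, which divide the
    undominated part by [2 ^ q], more than twice the order of the dense minor.
    The others come from [128 r] picks, which divide it by [2 ^ (2 r)]; with
    [g = 2 ^ r] the proportion of missed neighbours is below [2 ^ - (r ^ 2)],
    hence by hypothesis at most [t] repairs are made. The total is at most
    [128 q s + 256 r t + t], within half of [h = 1024 r t]. *)
Lemma sparse_model (G H : sgraph) (S : {set H}) (t r q : nat) :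
  #|~: S| = t -> 0 < t -> 1 < r -> #|arcs (del_vertices S)| + 2 * t <= t * 2 ^ (r ^ 2) ->
  64 * (1024 * (r * t)) < 2 ^ q -> q * #|S| <= t ->
  0 < #|G| -> 32 * (1024 * (r * t)) * #|G| <= #|arcs G| -> model H G.
Proof.
move=> cS t0 r1 sparse qP qS G0 dense.
pose h := 1024 * (r * t).
have rt : 1 < r * t by nia.
have h12 : 12 <= h by rewrite /h; lia.
have [M [MG M0 cM codegM]] := @dense_neighbourhood_minor h G h12 G0 dense.
apply: MG; have h0 : 0 < h by lia.
have q0 : 0 < q by case: (q) qP => //; rewrite expn0; nia.
pose ss := enum S; pose vs := [seq val u | u <- enum (del_vertices S)].
have size_ss : size ss = #|S| by rewrite -cardE.
have size_vs : size vs = t.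
  by rewrite size_map -cardE card_del_vertices.
have [||||F0 [pl0 und0 c0]] := @place_dominating M h h0 cM codegM H (64 * q) ss M0.
- by rewrite muln_gt0.
- have := double_expn_iter 63 q; have : 0 < 63 ^ (64 * q) by rewrite expn_gt0.
  have : 2 * #|M| < 2 ^ q by apply: leq_ltn_trans qP; rewrite /h in cM; lia.
  by move: (2 ^ q) (63 ^ _) (64 ^ _) => a b c; nia.
- exact: enum_uniq.
- by rewrite size_ss /h; nia.
have cover v : v \in vs ++ ss.
  rewrite mem_cat mem_enum orbC; have [//|vS] := boolP (v \in S).
  by apply/mapP; exists (Sub v vS : del_vertices S); rewrite ?mem_enum.
have [|||||F [pl _ _ _]] := @place_sparse M h h0 cM codegM H (128 * r) (2 ^ r)
    (2 * (64 * q) * size ss) F0 ss vs M0 _ _ pl0 und0 c0.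
- by rewrite muln_gt0; lia.
- have -> : 128 * r = 64 * (2 * r) by lia.
  apply: leq_trans (double_expn_iter 63 (2 * r)).
  by rewrite leq_mul2r -[4]/(2 ^ 2) -expnD leq_exp2l //; lia.
- rewrite cat_uniq enum_uniq map_inj_uniq ?enum_uniq ?andbT /=; last exact: val_inj.
  apply/hasPn=> v; rewrite mem_enum => vS; apply/mapP=> -[u _ vu].
  by have := valP u; rewrite -vu vS.
- have := back_edges_del_vertices S; rewrite -/vs size_vs size_ss => eb.
  have big : 2 ^ (r ^ 2) <= (2 ^ r) ^ (128 * r).
    by rewrite -expnM leq_exp2l // -mulnn; nia.
  have : 2 * (back_edges vs + t) <= t * (2 ^ r) ^ (128 * r) by nia.
  move: ((2 ^ r) ^ (128 * r)) => Q le_Q.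
  have : Q * (2 * (64 * q) * #|S|) <= Q * (128 * t) by rewrite leq_mul2l; apply/orP; right; lia.
  have : Q * (258 * t + 512 * (r * t)) <= Q * h by rewrite leq_mul2l /h; apply/orP; right; nia.
  by lia.
- by rewrite expn_gt0.
exact: placed_model cover pl.
Qed.

(** * The logarithmic bound *)

From mathcomp Require Import classical_sets reals constructive_ereal ereal exp.

Local Open Scope ring_scope.

Lemma card_arcs_edges (G : sgraph) : #|arcs G| = (2 * #|edges G|)%N.
Proof.
pose ends (p : G * G) : {set G} := [set p.1; p.2]%SET.
rewrite -sum1_card (partition_big ends (mem (edges G))) /=; last first.
  move=> [x y]; rewrite in_arcs /= => xy; rewrite inE.
  by apply/existsP; exists x; apply/existsP; exists y; rewrite xy /=.
rewrite mulnC -sum_nat_const; apply: eq_bigr => e.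
rewrite inE => /existsP[x /existsP[y /andP[xy /eqP->]]].
rewrite (eq_bigl (mem [set (x, y); (y, x)]%SET)) ?sum1_card; last first.
  move=> [u v]; rewrite /ends /= in_arcs !inE /= !xpair_eqE.
  apply/andP/orP => [[_ /eqP/set2_eq[[-> ->]|[-> ->]]]|]; rewrite ?eqxx; auto.
  case=> /andP[/eqP-> /eqP->]; first by rewrite xy.
  by rewrite adj_sym xy finset.setUC.
by rewrite cards2 xpair_eqE (negPf (contracted_neq xy)).
Qed.

Lemma avg_degE (R : realType) (G : sgraph) :
  avg_deg R G = #|arcs G|%:R / #|G|%:R.
Proof. by rewrite /avg_deg card_arcs_edges natrM. Qed.

Lemma half_le_ln2 (R : realType) : 2^-1 <= ln 2 :> R.
Proof.
have -> : 2 = (2^-1)^-1 :> R by rewrite invrK.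
rewrite lnV ?posrE; last by lra.
have := @le_ln1Dx R (- 2^-1); rewrite (_ : 1 + - 2^-1 = 2^-1); last lra.
move=> ln_half; suff /ln_half : -1 < - 2^-1 :> R by lra.
by lra.
Qed.

(** The least [r >= 2] with [d + 2 <= 2 ^ (r ^ 2)], where [d = E / t]: minimality
    bounds it in terms of [sqrt (ln (d + 2))], and [r <= t] because [d <= t]. *)
Lemma exists_quadratic_exponent (E t : nat) : (2 < t)%N -> (E <= t ^ 2)%N ->
  exists r : nat, [/\ (1 < r <= t)%N, (E + 2 * t <= t * 2 ^ (r ^ 2))%N &
    (t * 2 ^ (r.-1 ^ 2) < E + 2 * t)%N \/ r = 2].
Proof.
move=> t2 Et.
pose P r := (1 < r)%N && (E + 2 * t <= t * 2 ^ (r ^ 2))%N.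
have Pt : P t.
  rewrite /P (ltn_trans _ t2) //=.
  have : (t + 2 <= 2 ^ (t ^ 2))%N.
    by have := ltn_expl (t ^ 2) (isT : (1 < 2)%N); rewrite -mulnn; nia.
  by move: Et; rewrite -[(t ^ 2)%N in X in X -> _]mulnn; nia.
have exP : exists r, P r by exists t.
have [r /andP[r1 rE] minr] := ex_minnP exP.
exists r; split=> //; first by rewrite r1 minr.
have [/eqP r2|r2] := boolP (r == 2%N); [by right | left].
rewrite ltnNge; apply/negP=> le_r.
suff : (r <= r.-1)%N by lia.
by apply: minr; rewrite /P le_r andbT; lia.
Qed.

Lemma exponent_le_sqrt_ln (R : realType) (E t r : nat) : (0 < t)%N -> (1 < r)%N ->
  (t * 2 ^ (r.-1 ^ 2) < E + 2 * t)%N \/ r = 2%N ->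
  r%:R <= 4 * Num.sqrt (ln (E%:R / t%:R + 2)) :> R.
Proof.
move=> t0 r1 r_min; have ln2 := half_le_ln2 R.
have tR : 0 < t%:R :> R by rewrite ltr0n.
have d0 : 0 <= E%:R / t%:R :> R by rewrite divr_ge0.
set x := ln _; have x2 : ln 2 <= x by rewrite ler_ln ?posrE ?lerDr.
have x0 : 0 <= x by lra.
suff : r%:R ^+ 2 <= 16 * x.
  have := sqr_sqrtr x0; have := sqrtr_ge0 x; have : 0 <= r%:R :> R by [].
  by nra.
case: r_min => [lt_r|->]; last by lra.
have : (r.-1 ^ 2)%:R * ln 2 <= x.
  rewrite mulr_natl -lnXn // ler_ln ?posrE ?exprn_gt0 //.
  rewrite -(ler_pM2l tR) mulrDr mulrCA divff ?gt_eqF // mulr1.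
  by rewrite -natrX -!natrM -natrD ler_nat mulnC [(t * 2)%N]mulnC ltnW // mulnC.
have : r%:R <= 2 * r.-1%:R :> R by rewrite -natrM ler_nat; lia.
have : 0 <= r.-1%:R :> R by [].
have : 0 <= r%:R :> R by [].
by rewrite natrX; nra.
Qed.

(** As [r <= t], the logarithm is [O(ln t)], and the hypothesis on [s] absorbs the
    constant: the left factor is at most [38 ln t], and [38 <= 10 ^ 5]. *)
Lemma trunc_log_mul_le (R : realType) (s t r : nat) : (2 < t)%N -> (0 < r <= t)%N ->
  s%:R <= 10 ^- 5 * (t%:R / ln t%:R) :> R ->
  ((trunc_log 2 (64 * (1024 * (r * t)))).+1 * s <= t)%N.
Proof.
move=> t2 /andP[r0 rt] sR; have ln2 := half_le_ln2 R.
have tR : 0 < t%:R :> R by rewrite ltr0n; lia.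
set q := trunc_log _ _; set L := ln t%:R in sR.
have L2 : ln 2 <= L by rewrite ler_ln ?posrE // ler_nat ltnW.
have q_le : q%:R * ln 2 <= 16 * ln 2 + 2 * L.
  have pow : (2 ^ q <= 2 ^ 16 * t ^ 2)%N.
    apply: (@leq_trans (64 * (1024 * (r * t)))); first by apply: trunc_logP; lia.
    by rewrite (expnD 2 6 10) -mulnA !leq_mul // -mulnn leq_mul2r rt orbT.
  move: pow; rewrite -(ler_nat R) natrM !natrX => pow.
  rewrite mulr_natl -[16]/(16%:R) -[2 * L]/(2%:R * L) !mulr_natl -!lnXn //.
  by rewrite -lnM ?posrE ?exprn_gt0 // ler_ln ?posrE ?mulr_gt0 ?exprn_gt0.
rewrite -(ler_nat R) natrM.
have qL : q.+1%:R <= 38 * L by rewrite -natr1; nra.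
have tE : t%:R = t%:R / L * L by rewrite divfK // gt_eqF //; lra.
have w0 : 0 < t%:R / L by rewrite divr_gt0 //; lra.
have s_le : s%:R <= 10^-1 ^+ 5 * (t%:R / L) by rewrite exprVn.
rewrite [leRHS]tE; move: (t%:R / L) w0 s_le => w w0 s_le.
have s0 : 0 <= s%:R :> R by [].
by nra.
Qed.

Lemma arcs_le_sq (G : sgraph) : (#|arcs G| <= #|G| ^ 2)%N.
Proof. by rewrite -mulnn -card_prod max_card. Qed.

Theorem theorem3 (R : realType) :
  exists c : R, forall s t : nat,
    (3 <= t)%N ->
    s%:R <= 10 ^- 5 * (t%:R / ln t%:R) :> R ->
    forall (H : sgraph) (S : {set H}),
      #|H| = (s + t)%N ->
      #|S| = s ->
      (extremal R H <=
        (c * t%:R * Num.sqrt (ln (avg_deg R (del_vertices S) + 2)))%:E)%E.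
Proof.
(* Density [32 * 1024 * r * t] is needed, and [r <= 4 * sqrt (ln (d + 2))]. *)
exists (4 * (32 * 1024)) => s t t3 sR H S cH cS.
have cSC : #|~: S|%SET = t by have := cardsC S; rewrite cS cH => /addnI.
rewrite avg_degE card_del_vertices cSC.
have [|r [/andP[r1 rt] rE r_min]] := @exists_quadratic_exponent #|arcs (del_vertices S)| t t3.
  by rewrite -cSC -card_del_vertices arcs_le_sq.
have r_le := @exponent_le_sqrt_ln R _ t r (ltn_trans (isT : 0 < 2)%N t3) r1 r_min.
set D := _ * t%:R * _.
have tR : 0 < t%:R :> R by rewrite ltr0n; lia.
have le_D : (32 * (1024 * (r * t)))%:R <= D.
  rewrite !natrM /D; move: r_le tR; move: r%:R t%:R (Num.sqrt _) => x y z xz y0; nra.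
have D0 : 0 < D by apply: lt_le_trans le_D; rewrite ltr0n; nia.
apply: ereal_inf_lbound; exists D => // G GD.
have G0 : (0 < #|G|)%N.
  rewrite lt0n; apply/eqP=> cG; move: GD.
  by rewrite avg_degE cG invr0 mulr0 leNgt D0.
apply: model_minor; apply: (@sparse_model G H S t r
    (trunc_log 2 (64 * (1024 * (r * t)))).+1) => //.
- by lia.
- exact: trunc_log_ltn.
- by rewrite cS; apply: (@trunc_log_mul_le R) => //; lia.
- rewrite -(ler_nat R) natrM; have := le_trans le_D GD.
  by rewrite avg_degE ler_pdivlMr // ltr0n.
Qed.
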